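(* There exists a universal constant $C>0$ such that the following holds for all $\mu,\nu$ satisfying the standing assumptions and all $\varepsilon>0$. Assume that $\nabla\varphi$ is $L$-Lipschitz. Then for all $(x,y)\in\operatorname{spt}\pi_\varepsilon$ we have $$\|y-\nabla\varphi(x)\|\le r\quad\text{or}\quad d(x,\partial\operatorname{spt}\mu)\le r,\qquad\text{where } r:=C(L+1)^{3/2}\sqrt{\delta\Big(\frac{\delta(\varepsilon)}{L+1}\Big)}.$$
   Context: Work in $\mathbb R^d$, $d\in\mathbb N$, with Euclidean norm; $B(x,r)$ is the open ball, $d(x,A)=\inf_{y\in A}\|x-y\|$, and $\partial A$ is the topological boundary of $A\subseteq\mathbb R^d$. Standing assumptions: $\mu$ is a Borel probability measure on $\mathbb R^d$, absolutely continuous with respect to Lebesgue measure, $\operatorname{spt}\mu\subseteq B(0,1)$, and the interior of $\operatorname{spt}\mu$ is connected; $\nu$ is a Borel probability measure on $\mathbb R^d$ with $\operatorname{spt}\nu\subseteq B(0,1)$. $\varphi:\mathbb R^d\to\mathbb R$ is the Brenier potential, i.e. a convex function with $\nu=(\nabla\varphi)_\sharp\mu$; $\nabla\varphi$ is the Monge map for the quadratic cost. Put $c(x,y)=\tfrac12\|x-y\|^2$ and $\mathbb P=\mu\otimes\nu$ (so $\operatorname{spt}\mathbb P=\operatorname{spt}\mu\times\operatorname{spt}\nu$). $\varepsilon$-spread of $\mu$: $\delta(\varepsilon):=\inf\{r>0: r\cdot\rho(r)>\varepsilon\}$, where $\rho(r):=\inf_{x\in\operatorname{spt}\mu}\mu(B(x,r))$.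 Quadratically regularized optimal transport: for $\varepsilon>0$, $\pi_\varepsilon$ is the unique minimizer over couplings $\pi$ of $\mu$ and $\nu$ of $\int c\,d\pi+\frac{\varepsilon}{2}\|\frac{d\pi}{d\mathbb P}\|^2_{L^2(\mathbb P)}$. It has density $\frac{d\pi_\varepsilon}{d\mathbb P}(x,y)=\frac1\varepsilon[f_\varepsilon(x)+g_\varepsilon(y)-c(x,y)]_+$, where the optimal dual potentials $f_\varepsilon,g_\varepsilon:\mathbb R^d\to\mathbb R$ are continuous and determined, up to a constant shift $(f_\varepsilon+a,g_\varepsilon-a)$, by $$\int[f_\varepsilon(x)+g_\varepsilon(y)-c(x,y)]_+\,\mu(dx)=\varepsilon\ \ \forall y\in\mathbb R^d,\qquad \int[f_\varepsilon(x)+g_\varepsilon(y)-c(x,y)]_+\,\nu(dy)=\varepsilon\ \ \forall x\in\mathbb R^d.$$ The support of $\pi_\varepsilon$ is $\operatorname{spt}\pi_\varepsilon:=\overline{\{(x,y)\in\operatorname{spt}\mathbb P: f_\varepsilon(x)+g_\varepsilon(y)>c(x,y)\}}$. *)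

(* Defs.v *)
From HB Require Import structures.
From mathcomp Require Import all_boot all_order all_algebra.
From mathcomp Require Import all_classical all_reals all_analysis.

Set Implicit Arguments.
Unset Strict Implicit.
Unset Printing Implicit Defensive.

Import Order.TTheory GRing.Theory Num.Theory.
Import numFieldNormedType.Exports.

Local Open Scope classical_set_scope.
Local Open Scope ring_scope.
Local Open Scope charge_scope.

(* Borel sigma-algebra. The topology (and differentiability) that the library
   puts on 'rV[R]_d comes from the sup norm and is the Euclidean one. *)
#[warnings="-redundant-canonical-projection,-projection-no-head-constant"]
HB.instance Definition _ (R : realType) (m n : nat) :=
  @isMeasurable.Build default_measure_display 'M[R]_(m, n)
    <<s @open 'M[R]_(m, n) >>
    (@sigma_algebra0 _ setT _) (@sigma_algebraC _ _)
    (@sigma_algebra_bigcup _ setT _).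

Section euclidean.
Context {R : realType} {d : nat}.
Implicit Types (x y : 'rV[R]_d) (A : set 'rV[R]_d) (r : R).

(* The library's norm on 'rV[R]_d is the sup norm. *)
Definition enorm x : R := Num.sqrt (\sum_i x ord0 i ^+ 2).

Definition eball x r : set 'rV[R]_d := [set y | enorm (y - x) < r].

Definition dist_to_set x A : R := inf [set enorm (x - y) | y in A].

Definition boundary A : set 'rV[R]_d := closure A `\` interior A.

Definition grad (phi : 'rV[R]_d -> R) x : 'rV[R]_d :=
  \row_i 'D_(delta_mx ord0 i) phi x.

Definition box (a b : 'rV[R]_d) : set 'rV[R]_d :=
  [set x | forall i, a ord0 i <= x ord0 i <= b ord0 i].

(* d-dimensional Lebesgue outer measure, from countable covers by boxes;
   its restriction to Borel sets is Lebesgue measure. *)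
Definition lebesgue_outer A : \bar R :=
  ereal_inf [set s | exists (D : set nat) (a b : nat -> 'rV[R]_d),
    [/\ forall k i, a k ord0 i <= b k ord0 i,
        A `<=` \bigcup_(k in D) box (a k) (b k)
      & s = \esum_(k in D) (\prod_i (b k ord0 i - a k ord0 i))%:E]].

Definition quad_cost x y : R := enorm (x - y) ^+ 2 / 2.

Definition spt (mu : set 'rV[R]_d -> \bar R) : set 'rV[R]_d :=
  [set x | forall r, 0 < r -> (0 < mu (eball x r))%E].

Definition min_mass (mu : set 'rV[R]_d -> \bar R) r : R :=
  inf [set fine (mu (eball x r)) | x in spt mu].

Definition spread (mu : set 'rV[R]_d -> \bar R) (eps : R) : R :=
  inf [set r | 0 < r /\ eps < r * min_mass mu r].

End euclidean.

Section transport.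
Context {R : realType} {d : nat}.
Implicit Types (mu nu : probability 'rV[R]_d R) (eps L : R).
Implicit Types (phi f g : 'rV[R]_d -> R).
Implicit Types gamma : probability ('rV[R]_d * 'rV[R]_d)%type R.

Definition indep_prob mu nu : probability ('rV[R]_d * 'rV[R]_d)%type R :=
  (mu \x nu)%E.

Definition lipschitz_gradient L phi : Prop :=
  (forall x, differentiable phi x) /\
  (forall x y, enorm (grad phi x - grad phi y) <= L * enorm (x - y)).

(* [grad phi x] is meaningful only where [phi] is differentiable, which holds
   Lebesgue-a.e., hence mu-a.e., for convex [phi] and absolutely continuous mu. *)
Definition brenier_potential mu nu phi : Prop :=
  convex_function [set: convex_lmodType 'rV[R]_d] phi /\
  (forall A, measurable A -> nu A = pushforward mu (grad phi) A).

Definition coupling mu nu gamma : Prop :=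
  (forall A, measurable A -> gamma (A `*` setT) = mu A) /\
  (forall B, measurable B -> gamma (setT `*` B) = nu B).

(* The library's Radon-Nikodym derivative is constantly -oo when gamma is not
   absolutely continuous, in which case the penalty is +oo. *)
Definition qot_objective mu nu eps gamma : \bar R :=
  (\int[gamma]_z (quad_cost z.1 z.2)%:E +
   (eps / 2)%:E *
     'N[indep_prob mu nu]_2%:E
       ['d (charge_of_finite_measure gamma) '/d (indep_prob mu nu)] ^+ 2)%E.

Definition qot_plan mu nu eps gamma : Prop :=
  coupling mu nu gamma /\
  (forall gamma', coupling mu nu gamma' ->
    (qot_objective mu nu eps gamma <= qot_objective mu nu eps gamma')%E).

Definition qot_slack f g x y : R := Num.max 0 (f x + g y - quad_cost x y).

Definition qot_potentials mu nu eps gamma f g : Prop :=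
  [/\ continuous f /\ continuous g,
      forall y, (\int[mu]_x (qot_slack f g x y)%:E = eps%:E)%E,
      forall x, (\int[nu]_y (qot_slack f g x y)%:E = eps%:E)%E
    & {ae indep_prob mu nu, forall z,
        ('d (charge_of_finite_measure gamma) '/d (indep_prob mu nu)) z =
        (eps^-1 * qot_slack f g z.1 z.2)%:E}].

Definition qot_spt mu nu f g : set ('rV[R]_d * 'rV[R]_d) :=
  closure [set z | (spt mu `*` spt nu) z /\
                   quad_cost z.1 z.2 < f z.1 + g z.2].

End transport.

(* Main.v *)
Require Import Defs.
From HB Require Import structures.
From mathcomp Require Import all_boot all_order all_algebra.
From mathcomp Require Import all_classical all_reals all_analysis.
From mathcomp Require Import measurable_realfun ring lra.
Set Implicit Arguments.
Unset Strict Implicit.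
Unset Printing Implicit Defensive.
Import Order.TTheory GRing.Theory Num.Theory.
Import numFieldNormedType.Exports.
Local Open Scope classical_set_scope.
Local Open Scope ring_scope.

(** Write [F x = enorm x ^+ 2 / 2 - f x] and [G y = enorm y ^+ 2 / 2 - g y] for the
    dual potentials [f] and [g]. Their optimality conditions then say that the
    positive part of the slack [S x y = edot x y - F x - G y] has integral [eps] in
    each variable, and the support of the regularized plan lies in [0 <= S]. Set
    [delta = spread mu eps] and [D = spread mu (delta / (L + 1))].

    The slack is small from above. Because both marginals live in the unit ball, the
    integral equations force [F] and [G] to be 1-Lipschitz
    ([potential_lipschitz]). Hence a large slack at [(x, y)] persists on a ball around
    [x], whose mass is controlled from below by the spread, while the integral of the
    positive part is only [eps]. This gives [S <= 3 * delta] on the support of [mu]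
    times the unit ball ([slack_le_spread]).

    Along the graph of the Brenier map the slack is also small from below. The
    function [S_+ / eps] is the density of a coupling of [mu] and [nu] on which [S] is
    nonnegative, and the Brenier map maximizes the correlation among couplings; testing
    with [phi] and its conjugate yields that the gap [S x (grad phi x)] has nonnegative
    [mu]-integral ([dual_pairing_ge0], [integral_gap_ge0]). The gap is Lipschitz with
    constant [2 * (L + 1)] and at most [3 * delta], so the spread argument applies once
    more and shows that it is at least [- 8 * (L + 1) * D] everywhere on the support
    ([gap_ge]). The iterated spread in the theorem comes from using the argument twice.

    Minty's trick turns these bounds into a distance ([dist_to_brenier_map]). Comparing
    the nonnegative slack at [(x, y)] and the gap at [x'] with the slack at the crossed
    pairs gives [edot (x - x') (y - grad phi x') >= - 14 * (L + 1) * D] for every [x']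
    in the support. Taking [x'] at distance [Num.sqrt D] from [x] in the direction of
    [y - grad phi x] bounds [enorm (y - grad phi x)] by [15 * (L + 1) * Num.sqrt D].
    This [x'] lies in the support as soon as [x] is farther than [Num.sqrt D] from its
    boundary ([mem_of_lt_dist_boundary]). *)

(** * Euclidean geometry of row vectors *)

Section euclidean_geometry.
Context {R : realType} {d : nat}.
Implicit Types (x y z : 'rV[R]_d) (a r : R).

Definition edot x y : R := \sum_i x ord0 i * y ord0 i.

Lemma edotC x y : edot x y = edot y x.
Proof. by apply: eq_bigr => i _; rewrite mulrC. Qed.

Lemma edotDl x y z : edot (x + y) z = edot x z + edot y z.
Proof. by rewrite -big_split; apply: eq_bigr => i _; rewrite mxE mulrDl. Qed.

Lemma edotZl a x y : edot (a *: x) y = a * edot x y.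
Proof. by rewrite mulr_sumr; apply: eq_bigr => i _; rewrite mxE mulrA. Qed.

Lemma edotNl x y : edot (- x) y = - edot x y.
Proof. by rewrite -scaleN1r edotZl mulN1r. Qed.

Lemma edotBl x y z : edot (x - y) z = edot x z - edot y z.
Proof. by rewrite edotDl edotNl. Qed.

Lemma edotDr x y z : edot x (y + z) = edot x y + edot x z.
Proof. by rewrite !(edotC x) edotDl. Qed.

Lemma edotZr a x y : edot x (a *: y) = a * edot x y.
Proof. by rewrite !(edotC x) edotZl. Qed.

Lemma edotBr x y z : edot x (y - z) = edot x y - edot x z.
Proof. by rewrite !(edotC x) edotBl. Qed.

Lemma edot_ge0 x : 0 <= edot x x.
Proof. by apply: sumr_ge0 => i _; rewrite -expr2 sqr_ge0. Qed.

Lemma sqr_enorm x : enorm x ^+ 2 = edot x x.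
Proof.
rewrite sqr_sqrtr; first by apply: eq_bigr => i _; rewrite expr2.
by apply: sumr_ge0 => i _; rewrite sqr_ge0.
Qed.

Lemma enorm_ge0 x : 0 <= enorm x.
Proof. exact: sqrtr_ge0. Qed.

Lemma enormZ a x : enorm (a *: x) = `|a| * enorm x.
Proof.
apply/eqP; rewrite -(@eqrXn2 _ 2) ?mulr_ge0 ?enorm_ge0 // exprMn !sqr_enorm.
by rewrite edotZl edotZr mulrA -expr2 real_normK ?num_real.
Qed.

Lemma enormN x : enorm (- x) = enorm x.
Proof. by rewrite -scaleN1r enormZ normrN1 mul1r. Qed.

Lemma enorm0 : enorm (0 : 'rV[R]_d) = 0.
Proof. by rewrite -(scale0r 0) enormZ normr0 mul0r. Qed.

Lemma enorm_distC x y : enorm (x - y) = enorm (y - x).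
Proof. by rewrite -enormN opprB. Qed.

Lemma coord_le_enorm x i : `|x ord0 i| <= enorm x.
Proof.
rewrite -(@ler_pXn2r _ 2) ?nnegrE ?enorm_ge0 // sqr_enorm real_normK ?num_real //.
rewrite /edot (bigD1 i) //= -expr2 lerDl.
by apply: sumr_ge0 => j _; rewrite -expr2 sqr_ge0.
Qed.

Lemma enorm_eq0 x : enorm x = 0 -> x = 0.
Proof.
move=> x0; apply/rowP => i; rewrite mxE; apply/eqP.
by rewrite -normr_le0 -x0 coord_le_enorm.
Qed.

(** Cauchy-Schwarz: expand the square of [enorm y *: x - enorm x *: y]. *)
Lemma edot_le x y : edot x y <= enorm x * enorm y.
Proof.
have [x0|x0] := eqVneq (enorm x) 0.
  rewrite (enorm_eq0 x0) enorm0 mul0r -(scale0r 0) edotZl mul0r //.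
have [y0|y0] := eqVneq (enorm y) 0.
  rewrite (enorm_eq0 y0) enorm0 mulr0 -(scale0r 0) edotZr mul0r //.
have := edot_ge0 (enorm y *: x - enorm x *: y).
rewrite !(edotBl, edotBr, edotZl, edotZr) -!sqr_enorm (edotC y x).
have xy0 : 0 < enorm x * enorm y.
  by rewrite mulr_gt0 // lt_def enorm_ge0 ?x0 ?y0.
have -> : forall a b c : R, b * (b * a ^+ 2 - a * c) - a * (b * c - a * b ^+ 2) =
    a * b * (2 * (a * b - c)) by move=> a b c; ring.
by rewrite pmulr_rge0 // pmulr_rge0 // subr_ge0.
Qed.

Lemma edot_abs_le x y : `|edot x y| <= enorm x * enorm y.
Proof. by rewrite ler_norml edot_le andbT lerNl -edotNl -(enormN x) edot_le. Qed.

Lemma ler_enormD x y : enorm (x + y) <= enorm x + enorm y.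
Proof.
rewrite -(@ler_pXn2r _ 2) ?nnegrE ?addr_ge0 ?enorm_ge0 //.
have := edot_le x y; rewrite sqr_enorm sqrrD !sqr_enorm edotDl !edotDr (edotC y x).
by move=> ?; lra.
Qed.

Lemma ler_enorm_dist x y z : enorm (x - z) <= enorm (x - y) + enorm (y - z).
Proof. by apply: le_trans (ler_enormD _ _); rewrite addrA subrK. Qed.

Lemma ler_dist_enorm x y : enorm x - enorm y <= enorm (x - y).
Proof. by rewrite lerBlDr -[x in enorm x](subrK y) ler_enormD. Qed.

Lemma mx_norm_le_enorm x : `|x| <= enorm x.
Proof.
rewrite [`|x|]mx_normrE; apply: (big_ind (fun a => a <= enorm x)); first exact: enorm_ge0.
  by move=> a b xa xb; rewrite ge_max xa xb.
by move=> [i j] _; rewrite (ord1 i) coord_le_enorm.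
Qed.

Lemma coord_le_mx_norm x i : `|x ord0 i| <= `|x|.
Proof.
rewrite [`|x|]mx_normrE.
exact: (le_bigmax _ (fun ij => `|x ij.1 ij.2|) (ord0, i)).
Qed.

Lemma enorm_le_mx_norm x : enorm x <= d.+1%:R * `|x|.
Proof.
rewrite -(@ler_pXn2r _ 2) ?nnegrE ?mulr_ge0 ?enorm_ge0 // sqr_enorm exprMn.
apply: (@le_trans _ _ (\sum_(i < d) `|x| ^+ 2)).
  apply: ler_sum => i _; rewrite -expr2 -real_normK ?num_real //.
  by rewrite ler_pXn2r ?nnegrE // coord_le_mx_norm.
rewrite sumr_const card_ord -[_ *+ d]mulr_natl ler_wpM2r ?sqr_ge0 //.
by rewrite -natrX ler_nat (leq_trans (leqnSn d)) // expnS leq_pmulr ?expn_gt0.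
Qed.

(** Euclidean balls generate the topology, although the norm of the row-vector
    space is the sup norm: each norm bounds the other up to a factor. *)
Lemma nbhs_eballP x (A : set 'rV[R]_d) :
  nbhs x A <-> exists2 r, 0 < r & eball x r `<=` A.
Proof.
split=> [/nbhs_ballP[e e0 xA]|[r r0 xA]].
  exists e => // y; rewrite /eball /= => xy; apply: xA.
  rewrite -ball_normE /= distrC; exact: le_lt_trans (mx_norm_le_enorm _) xy.
apply/nbhs_ballP; exists (r / d.+1%:R) => /=; first by rewrite divr_gt0.
move=> y; rewrite -ball_normE /= distrC => xy; apply: xA; rewrite /eball /=.
apply: le_lt_trans (enorm_le_mx_norm _) _.
by rewrite mulrC -ltr_pdivlMr.
Qed.

Lemma eball_center x r : 0 < r -> eball x r x.
Proof. by move=> r0; rewrite /eball /= subrr enorm0. Qed.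

Lemma open_eball x r : open (eball x r).
Proof.
rewrite openE => y; rewrite /eball /= => xy; apply/nbhs_eballP.
exists (r - enorm (y - x)); first by rewrite subr_gt0.
move=> z; rewrite /eball /= => yz.
by apply: le_lt_trans (ler_enorm_dist _ y _) _; rewrite -ltrBrDr.
Qed.

Lemma closure_eballP x (A : set 'rV[R]_d) :
  closure A x <-> forall r, 0 < r -> exists2 y, A y & enorm (y - x) < r.
Proof.
split=> [Ax r r0|Ax B /nbhs_eballP[r r0 xB]].
  have [|y [Ay xy]] := Ax (eball x r); last by exists y.
  by apply/nbhs_eballP; exists r.
by have [y Ay xy] := Ax r r0; exists y; split=> //; apply: xB.
Qed.

Lemma enorm_lipschitz_continuous (f : 'rV[R]_d -> R) K :
  (forall x y, `|f x - f y| <= K * enorm (x - y)) -> continuous f.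
Proof.
move=> fK x; apply/(@cvgrPdist_lt _ _ _ (nbhs x) (nbhs_filter x)) => e e0.
apply/nbhs_eballP.
have K0 : 0 < `|K| + 1 by rewrite ltr_wpDl.
exists (e / (`|K| + 1)); first by rewrite divr_gt0.
move=> y; rewrite /eball /= => xy; apply: le_lt_trans (fK _ _) _.
rewrite enorm_distC; move: xy; rewrite ltr_pdivlMr // mulrC => xy.
apply: le_lt_trans xy; rewrite ler_wpM2r ?enorm_ge0 //.
by apply: le_trans (ler_norm K) _; rewrite lerDl.
Qed.

End euclidean_geometry.

(** * Borel probabilities, supports and spread *)

Section borel_row_vectors.
Context {R : realType} {d : nat}.
Implicit Types (mu : probability 'rV[R]_d R).

Lemma open_measurable_rV (A : set 'rV[R]_d) : open A -> measurable A.
Proof. by move=> oA; apply: sub_sigma_algebra. Qed.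

Lemma continuous_measurable_fun_rV (f : 'rV[R]_d -> R) :
  continuous f -> measurable_fun setT f.
Proof.
move=> /continuousP cf; apply: (measurability _ (RGenOpens.measurableE R)).
move=> /= _ [_ [a [b ->]]] <-; rewrite setTI; apply: open_measurable_rV.
by apply: cf; exact: interval_open.
Qed.

Lemma continuous_measurable_fun_rV_rV (f : 'rV[R]_d -> 'rV[R]_d) :
  continuous f -> measurable_fun setT f.
Proof.
move=> /continuousP cf; apply: (measurability (@open 'rV[R]_d)) => //.
by move=> _ [A oA <-]; rewrite setTI; apply: open_measurable_rV; exact: cf.
Qed.

Lemma measurable_eball (x : 'rV[R]_d) r : measurable (eball x r).
Proof. apply: open_measurable_rV. exact: open_eball. Qed.

Lemma rat_vector_dense (x : 'rV[R]_d) r : 0 < r ->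
  exists q : 'rV[rat]_d, enorm (map_mx ratr q - x) < r.
Proof.
move=> r0; have s0 : 0 < r / d.+1%:R by rewrite divr_gt0.
have xs i : exists q : rat, ratr q \in `]x ord0 i, x ord0 i + r / d.+1%:R[.
  by apply: rat_in_itvoo; rewrite ltrDl.
have [q qP] := choice xs.
exists (\row_i q i); apply: le_lt_trans (enorm_le_mx_norm _) _.
rewrite mulrC -ltr_pdivlMr // [`|_|]mx_normrE; apply: bigmax_lt => //.
move=> [i j] _; rewrite !mxE (ord1 i) /=.
have := qP j; rewrite in_itv /= => /andP[xq qx].
by rewrite gtr0_norm ?subr_gt0 // ltrBlDl.
Qed.

Lemma closed_spt mu : closed (spt mu).
Proof.
move=> x /closure_eballP xs r r0.
have [y ys yx] := xs (r / 2) ltac:(by rewrite divr_gt0).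
apply: lt_le_trans (ys (r / 2) _) _; first by rewrite divr_gt0.
apply: le_measure; rewrite ?inE; [exact: measurable_eball..|].
move=> z; rewrite /eball /= => zy; apply: le_lt_trans (ler_enorm_dist _ y _) _.
by rewrite (splitr r) ltrD.
Qed.

Lemma measurable_spt mu : measurable (spt mu).
Proof.
rewrite -(setCK (spt mu)); apply: measurableC; apply: open_measurable_rV.
apply: closed_openC; exact: closed_spt.
Qed.

(** Every point off the support lies in a null ball with rational centre and
    radius of the form [n.+1%:R^-1], and there are countably many of those. *)
Lemma measure_sptC mu : mu (~` spt mu) = 0.
Proof.
pose F (k : nat) : set 'rV[R]_d :=
  if unpickle k is Some (q, n) then
    let B := eball (map_mx ratr (q : 'rV[rat]_d)) (n.+1%:R^-1 : R) in
    if mu B == 0 then B else set0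
  else set0.
apply/negligibleP; first (apply: measurableC; exact: measurable_spt).
apply: (@negligibleS _ _ _ _ (\bigcup_k F k)); last first.
  apply: negligible_bigcup => k; rewrite /F; case: unpickle => [[q n]|]; last first.
    exact: negligible_set0.
  case: ifPn => [/eqP B0|_]; last exact: negligible_set0.
  by apply/negligibleP => //; exact: measurable_eball.
move=> x /existsNP[r /not_implyP[r0 /negP]]; rewrite -leNgt => xr0.
have xr : mu (eball x r) = 0 by apply/eqP; rewrite eq_le xr0 measure_ge0.
have [n n0 nr] : exists2 n : nat, True & (n.+1%:R^-1 : R) < r / 2.
  have [n _ nr] := near_infty_natSinv_lt (PosNum (divr_gt0 r0 (ltr0Sn _ 1))).
  by exists n => //; apply: nr => /=.
have [q qx] := @rat_vector_dense x (n.+1%:R^-1) ltac:(by rewrite invr_gt0).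
exists (pickle (q, n)) => //; rewrite /F pickleK.
have -> : mu (eball (map_mx ratr q) n.+1%:R^-1) == 0.
  rewrite eq_le measure_ge0 andbT -xr; apply: le_measure; rewrite ?inE.
  - exact: measurable_eball.
  - exact: measurable_eball.
  move=> z; rewrite /eball /= => zq.
  apply: le_lt_trans (ler_enorm_dist _ (map_mx ratr q) _) _.
  by rewrite (splitr r) ltrD // (lt_trans _ nr).
by rewrite /eball /= enorm_distC.
Qed.

Lemma measure_eball01C mu : spt mu `<=` eball 0 1 -> mu (~` eball 0 1) = 0.
Proof.
move=> sB; apply/eqP; rewrite eq_le measure_ge0 andbT -(measure_sptC mu).
apply: le_measure; rewrite ?inE; last exact: subsetC.
- (apply: measurableC; exact: measurable_eball).
- (apply: measurableC; exact: measurable_spt).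
Qed.

Lemma spt_neq0 mu : spt mu !=set0.
Proof.
apply/set0P/eqP => s0; have := measure_sptC mu.
by rewrite s0 setC0 probability_setT => /eqP; rewrite onee_eq0.
Qed.

Lemma measure_full_subset mu (A B : set 'rV[R]_d) : measurable A -> measurable B ->
  mu (~` A) = 0 -> A `<=` B -> mu B = 1%E.
Proof.
move=> mA mB A0 AB; have B0 : mu (~` B) = 0.
  apply/eqP; rewrite eq_le measure_ge0 andbT -A0.
  by apply: le_measure; rewrite ?inE; [exact: measurableC..|exact: subsetC].
have := probability_setC mu (measurableC mB).
by rewrite setCK B0 sube0.
Qed.

End borel_row_vectors.

Section spread.
Context {R : realType} {d : nat} (mu : probability 'rV[R]_d R).
Hypothesis mu_ball : spt mu `<=` eball 0 1.
Implicit Types (r e : R).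

Let masses r := [set fine (mu (eball x r)) | x in spt mu].

Let masses_neq0 r : masses r !=set0.
Proof. by have [x xs] := spt_neq0 mu; exists (fine (mu (eball x r))), x. Qed.

Let masses_ge0 r : lbound (masses r) 0.
Proof. by move=> _ [x _ <-]; rewrite fine_ge0. Qed.

Lemma min_mass_le r x : spt mu x -> min_mass mu r <= fine (mu (eball x r)).
Proof. by move=> xs; apply: ge_inf; [exists 0; exact: masses_ge0|exists x]. Qed.

Lemma min_mass_ge r e :
  (forall x, spt mu x -> e <= fine (mu (eball x r))) -> e <= min_mass mu r.
Proof. by move=> er; apply: (lb_le_inf (masses_neq0 r)) => _ [x xs <-]; exact: er. Qed.

Let fine_mu_le A B : measurable A -> measurable B -> A `<=` B ->
  fine (mu A) <= fine (mu B).
Proof.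
move=> mA mB AB; apply: fine_le; rewrite ?fin_num_measure //.
by apply: le_measure; rewrite ?inE.
Qed.

Lemma min_mass_mono r e : r <= e -> min_mass mu r <= min_mass mu e.
Proof.
move=> re; apply: min_mass_ge => x xs; apply: le_trans (min_mass_le r xs) _.
apply: fine_mu_le; [exact: measurable_eball..|].
by move=> y; rewrite /eball /= => xy; exact: lt_le_trans re.
Qed.

Lemma min_mass_ge0 r : 0 <= min_mass mu r.
Proof. by apply: min_mass_ge => x _; exact: fine_ge0. Qed.

Lemma min_mass_le1 r : min_mass mu r <= 1.
Proof.
have [x xs] := spt_neq0 mu; apply: le_trans (min_mass_le r xs) _.
rewrite -lee_fin fineK ?fin_num_measure //; last exact: measurable_eball.
apply: probability_le1; exact: measurable_eball.
Qed.

Lemma min_mass_diameter : min_mass mu 2 = 1.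
Proof.
apply/eqP; rewrite eq_le min_mass_le1; apply: min_mass_ge => x /mu_ball.
rewrite /eball /= subr0 => x1.
rewrite (@measure_full_subset _ _ mu (eball 0 1)) //;
  [exact: measurable_eball..|exact: measure_eball01C|].
move=> y; rewrite /eball /= subr0 => y1.
by apply: le_lt_trans (ler_enormD _ _) _; rewrite enormN; lra.
Qed.

Let radii e := [set r | 0 < r /\ e < r * min_mass mu r].

Let radii_neq0 e : radii e !=set0.
Proof.
(* From radius 2 on, a ball centred in the support contains the whole unit ball. *)
exists (Num.max 2 (e + 1)); split; first by rewrite lt_max ltr0n.
have m1 : min_mass mu (Num.max 2 (e + 1)) = 1.
  have /min_mass_mono : 2 <= Num.max 2 (e + 1) by rewrite le_max lexx.
  by rewrite min_mass_diameter => m1; apply/eqP; rewrite eq_le min_mass_le1.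
by rewrite m1 mulr1 lt_max (ltrDl e) ltr01 orbT.
Qed.

(** The set of radii defining the spread is upward closed, because the minimal mass
    is nondecreasing in the radius. *)
Lemma lt_mass_of_spread_lt e r : spread mu e < r -> e < r * min_mass mu r.
Proof.
move=> er; have [r' [r'0 er'] r'r] := inf_lt (radii_neq0 e) er.
apply: lt_le_trans er' _; apply: ler_pM => //; first exact: ltW.
- exact: min_mass_ge0.
- exact: ltW.
- by apply: min_mass_mono; exact: ltW.
Qed.

(** A ball of radius [r] has mass at most [1], so [e < r * min_mass mu r] forces
    [e < r]. *)
Lemma spread_ge e : e <= spread mu e.
Proof.
apply: (lb_le_inf (radii_neq0 e)) => r [r0 /ltW er].
apply: le_trans er _.
by rewrite -[leRHS]mulr1 ler_wpM2l ?min_mass_le1 // ltW.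
Qed.

End spread.

(** * Convex functions and their conjugates *)

Section gradient_of_convex_function.
Context {R : realType} {d : nat} (phi : 'rV[R]_d -> R).
Implicit Types x y z v : 'rV[R]_d.

Lemma derive_edot_grad x v : differentiable phi x ->
  'D_v phi x = edot (grad phi x) v.
Proof.
move=> dphi; rewrite deriveE // {1}(row_sum_delta v) linear_sum.
by apply: eq_bigr => i _; rewrite linearZ /= mxE deriveE // mulrC.
Qed.

Hypothesis convex_phi : convex_function [set: convex_lmodType 'rV[R]_d] phi.

Lemma convex_function_chord x z t : 0 <= t <= 1 ->
  phi (x + t *: (z - x)) <= phi x + t * (phi z - phi x).
Proof.
move=> t01; have tP : Itv.spec (@Itv.num_sem R) (Itv.Real `[0, 1]%Z) t.
  by rewrite /Itv.spec /= /Itv.num_sem /= in_itv /= t01 num_real.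
have := @convex_phi (Itv.Def tP) z x; rewrite !inE => /(_ I I).
rewrite convRE /unstable.onem /= => H.
suff -> : x + t *: (z - x) = t *: z + (1 - t) *: x.
  by apply: le_trans H _; rewrite le_eqVlt; apply/orP; left; apply/eqP; ring.
by rewrite scalerBr scalerBl scale1r addrCA.
Qed.

(** A convex function lies above its tangent planes: difference quotients along
    [z - x] are bounded by the slope of the chord. *)
Lemma convex_tangent x z : differentiable phi x ->
  phi x + edot (grad phi x) (z - x) <= phi z.
Proof.
move=> dphi; rewrite -derive_edot_grad // -lerBrDl.
have dv : derivable phi x (z - x) by exact: diff_derivable.
apply: cvgr_to_le (cvg_dnbhs_at_right dv) _; near=> h.
have h0 : 0 < h by near: h; exact: nbhs_right_gt.
have h1 : h <= 1 by near: h; exact: nbhs_right_le.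
rewrite /= [h *: _ + x]addrC -[_ *: _]/(_ * _) ler_pdivrMl // lerBlDl.
by rewrite convex_function_chord // h1 ltW.
Unshelve. all: by end_near.
Qed.

End gradient_of_convex_function.

Section conjugate_on_the_ball.
Context {R : realType} {d : nat} (phi : 'rV[R]_d -> R).
Hypothesis convex_phi : convex_function [set: convex_lmodType 'rV[R]_d] phi.
Hypothesis diff_phi : forall x, differentiable phi x.
Implicit Types x y z : 'rV[R]_d.

(** The Legendre conjugate of [phi], with the supremum restricted to the closed unit
    ball: this keeps it finite for every [y], and it agrees with the full conjugate
    at the gradients of [phi] in that ball. *)
Definition ball_conjugate y : R :=
  sup [set edot x y - phi x | x in [set x | enorm x <= 1]].

Let vals y := [set edot x y - phi x | x in [set x | enorm x <= 1]].

Let has_sup_vals y : has_sup (vals y).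
Proof.
split; first by exists (edot 0 y - phi 0), 0 => //=; rewrite enorm0.
exists (enorm y + enorm (grad phi 0) - phi 0) => _ [x /= x1 <-].
have := convex_tangent convex_phi x (diff_phi 0); rewrite subr0 => px.
have := edot_le x y; have := edot_abs_le (grad phi 0) x.
rewrite ler_norml => /andP[gx _] xy.
have xy1 : enorm x * enorm y <= enorm y by rewrite ler_piMl ?enorm_ge0.
have gx1 : enorm (grad phi 0) * enorm x <= enorm (grad phi 0).
  by rewrite ler_piMr ?enorm_ge0.
by lra.
Qed.

Lemma ball_conjugate_ge x y : enorm x <= 1 -> edot x y - phi x <= ball_conjugate y.
Proof. by move=> x1; apply: ub_le_sup; [exact: (has_sup_vals y).2|exists x]. Qed.

Lemma ball_conjugate_le y a :
  (forall x, enorm x <= 1 -> edot x y - phi x <= a) -> ball_conjugate y <= a.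
Proof.
by move=> ya; apply: (ge_sup (has_sup_vals y).1) => _ [x x1 <-]; exact: ya.
Qed.

(** The tangent plane of [phi] at [x] lies below [phi], so the supremum is attained
    at [x]. *)
Lemma ball_conjugate_grad x : enorm x <= 1 ->
  ball_conjugate (grad phi x) = edot x (grad phi x) - phi x.
Proof.
move=> x1; apply/eqP; rewrite eq_le ball_conjugate_ge // andbT.
apply: ball_conjugate_le => z z1.
have := convex_tangent convex_phi z (diff_phi x).
by rewrite edotBr !(edotC (grad phi x)); lra.
Qed.

Lemma ball_conjugate_lipschitz y z :
  `|ball_conjugate y - ball_conjugate z| <= enorm (y - z).
Proof.
have half u v : ball_conjugate u - ball_conjugate v <= enorm (u - v).
  rewrite lerBlDl; apply: ball_conjugate_le => x x1.
  have := ball_conjugate_ge v x1; have := edot_le x (u - v).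
  have : enorm x * enorm (u - v) <= enorm (u - v) by rewrite ler_piMl ?enorm_ge0.
  by rewrite edotBr; lra.
by rewrite ler_norml half andbT lerNl opprB enorm_distC half.
Qed.

End conjugate_on_the_ball.

(** * Dual potentials and their slack *)

Section positive_slack.
Context {R : realType} {d : nat}.
Implicit Types (x y : 'rV[R]_d) (F G : 'rV[R]_d -> R).

Definition slack F G x y : R := edot x y - F x - G y.

Lemma slackC F G x y : slack F G x y = slack G F y x.
Proof. by rewrite /slack edotC addrAC. Qed.

Lemma measurable_coord (i : 'I_d) :
  measurable_fun setT (fun x : 'rV[R]_d => x ord0 i).
Proof.
apply: continuous_measurable_fun_rV.
apply: (@enorm_lipschitz_continuous _ _ _ 1) => x y; rewrite mul1r.
by have := coord_le_enorm (x - y) i; rewrite !mxE.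
Qed.

Lemma measurable_edot :
  measurable_fun setT (fun z : 'rV[R]_d * 'rV[R]_d => edot z.1 z.2).
Proof.
apply: measurable_sum => i; apply: measurable_funM.
- exact: (measurableT_comp (measurable_coord i) measurable_fst).
- exact: (measurableT_comp (measurable_coord i) measurable_snd).
Qed.

Lemma measurable_slack F G : measurable_fun setT F -> measurable_fun setT G ->
  measurable_fun setT (fun z : 'rV[R]_d * 'rV[R]_d => Num.max 0 (slack F G z.1 z.2)).
Proof.
move=> mF mG; apply: measurable_maxr; first exact: measurable_cst.
apply: measurable_funB; last exact: (measurableT_comp mG measurable_snd).
apply: measurable_funB; last exact: (measurableT_comp mF measurable_fst).
exact: measurable_edot.
Qed.

Lemma measurable_slackr F G x : measurable_fun setT F -> measurable_fun setT G ->
  measurable_fun setT (fun y => Num.max 0 (slack F G x y)).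
Proof. by move=> mF mG; exact: (measurable_fun_pair2 x (measurable_slack mF mG)). Qed.

(** If [F x'] exceeded [F x + enorm (x - x')] by [c > 0], passing from [x] to [x']
    would lower the slack by at least [c] on the unit ball; since both positive
    parts have the same integral, the positive part would vanish almost everywhere
    at [x], against [0 < e]. *)
Lemma potential_lipschitz (nu : probability 'rV[R]_d R) F G (e : R) :
  measurable_fun setT F -> measurable_fun setT G ->
  nu (~` eball 0 1) = 0 -> 0 < e ->
  (forall x, \int[nu]_y (Num.max 0 (slack F G x y))%:E = e%:E)%E ->
  forall x x', `|F x - F x'| <= enorm (x - x').
Proof.
move=> mF mG nu1 e0 inte.
suff half u v : F u - F v <= enorm (u - v).
  by move=> x x'; rewrite ler_norml half andbT lerNl opprB enorm_distC half.
rewrite leNgt; apply/negP => lt_uv.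
pose c := F u - F v - enorm (u - v); have c0 : 0 < c by rewrite subr_gt0.
pose P x y := Num.max 0 (slack F G x y).
have P0 x y : 0 <= P x y by rewrite le_max lexx.
have mP x : measurable_fun setT (EFin \o P x).
  by apply/measurable_EFinP; exact: measurable_slackr.
(* The loss of the positive part between [v] and [u]; it vanishes only where
   [P v] does. *)
pose m y := Num.min c (P v y).
have m0 y : 0 <= m y by rewrite le_min P0 ltW.
have mm : measurable_fun setT (EFin \o m).
  apply/measurable_EFinP; apply: measurable_minr; first exact: measurable_cst.
  exact: measurable_slackr.
have Pm y : eball 0 1 y -> P u y + m y <= P v y.
  rewrite /eball /= subr0 => y1.
  have uv : slack F G u y <= slack F G v y - c.
    have := edot_le (u - v) y; rewrite edotBl /slack /c.
    have : enorm (u - v) * enorm y <= enorm (u - v).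
      by rewrite ler_piMr ?enorm_ge0 // ltW.
    by move=> ? ?; lra.
  rewrite /m /P; case: (lerP 0 (slack F G u y)) => u0;
    case: (lerP 0 (slack F G v y)) => v0; by rewrite /Num.min; case: ifP; lra.
have Im : (\int[nu]_y (m y)%:E = 0)%E.
  have : (\int[nu]_y ((P u y)%:E + (m y)%:E) <= \int[nu]_y (P v y)%:E)%E.
    apply: ae_ge0_le_integral => //.
    - by move=> y _; rewrite adde_ge0 ?lee_fin.
    - by apply: emeasurable_funD; [exact: mP|exact: mm].
    - by move=> y _; rewrite lee_fin.
    - exact: mP.
    exists (~` eball 0 1); split => //.
      by apply: measurableC; exact: measurable_eball.
    by apply: subsetC => y y1 _; rewrite -EFinD lee_fin Pm.
  rewrite ge0_integralD //; try by move=> y _; rewrite lee_fin.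
  - rewrite !inte -[leRHS]adde0 leeD2lE // => m_le0.
    by apply/eqP; rewrite eq_le m_le0 integral_ge0 // => y _; rewrite lee_fin.
  - exact: mP.
have m_ae : ae_eq nu setT (EFin \o m) (cst 0%E).
  apply/ae_eq_integral_abs => //; rewrite -[RHS]Im.
  by apply: eq_integral => y _; rewrite gee0_abs ?lee_fin.
have : (\int[nu]_y (P v y)%:E = \int[nu]_y (cst 0 y))%E.
  apply: ae_eq_integral => //; first exact: mP.
  apply: filterS m_ae => y /= /(_ I) [my] _; congr EFin.
  by move: my; rewrite /m /Num.min; case: ifP => // _ c_eq0; lra.
by rewrite inte integral_cst // mul0e => -[] /eqP; rewrite gt_eqF.
Qed.

(** If the slack is [s] at [(x, y)] with [y] in the unit ball, it is at least
    [s / 3] on the ball of radius [s / 3] around [x], whose mass is then at most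
    [e / (s / 3)]. *)
Lemma slack_le_spread (mu : probability 'rV[R]_d R) F G (e : R) :
  measurable_fun setT F -> measurable_fun setT G ->
  spt mu `<=` eball 0 1 -> 0 < e ->
  (forall x x', `|F x - F x'| <= enorm (x - x')) ->
  (forall y, \int[mu]_x (Num.max 0 (slack F G x y))%:E = e%:E)%E ->
  forall x y, spt mu x -> enorm y <= 1 -> slack F G x y <= 3 * spread mu e.
Proof.
move=> mF mG mu1 e0 F_lip inte x y xs y1; rewrite leNgt; apply/negP => s_gt.
pose r := slack F G x y / 3.
have spr : spread mu e < r by rewrite /r ltr_pdivlMr // mulrC.
have r0 : 0 < r by apply: lt_trans spr; exact: lt_le_trans e0 (spread_ge mu1 e).
have := lt_mass_of_spread_lt mu1 spr; rewrite ltNge => /negP; apply.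
apply: (@le_trans _ _ (r * fine (mu (eball x r)))).
  by rewrite ler_wpM2l ?min_mass_le // ltW.
rewrite -lee_fin EFinM fineK; last by apply: fin_num_measure; exact: measurable_eball.
have mI : measurable_fun setT (EFin \o (\1_(eball x r) : 'rV[R]_d -> R)).
  by apply/measurable_EFinP; apply: measurable_indic; exact: measurable_eball.
have <- : (\int[mu]_z (\1_(eball x r) z)%:E = mu (eball x r))%E.
  by rewrite integral_indic ?setIT //; exact: measurable_eball.
rewrite -(inte y) -ge0_integralZl //; last by rewrite lee_fin ltW.
apply: ge0_le_integral => //.
- by move=> z _; rewrite -EFinM lee_fin mulr_ge0 // ltW.
- exact: measurable_funeM.
- apply/measurable_EFinP.
  exact: (measurable_fun_pair1 y (measurable_slack mF mG)).
move=> z _; rewrite -EFinM lee_fin indicE le_max.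
have [|_] := boolP (z \in eball x r); last by rewrite mulr0 lexx.
rewrite inE /eball /= => zx; rewrite mulr1; apply/orP; right.
have := edot_le (x - z) y; rewrite edotBl enorm_distC.
have : enorm (z - x) * enorm y <= enorm (z - x) by rewrite ler_piMr ?enorm_ge0.
have := F_lip z x; rewrite ler_norml => /andP[_].
have : slack F G x y = 3 * r by rewrite /r mulrC divfK.
rewrite /slack; lra.
Qed.

End positive_slack.

(** * Integrals against couplings *)

Section integration_lemmas.
Context {R : realType}.

Lemma ae_bounded_integrable d (T : measurableType d) (mu : probability T R)
    (D : set T) (f : T -> R) (M : R) :
  measurable D -> mu (~` D) = 0 -> measurable_fun setT f ->
  (forall x, D x -> `|f x| <= M) -> mu.-integrable setT (EFin \o f).
Proof.
move=> mD D0 mf fM; have mfE : measurable_fun setT (EFin \o f) by exact/measurable_EFinP.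
apply/(negligible_integrable (measurableC mD) measurableT mfE D0).
rewrite setTD setCK; apply: measurable_bounded_integrable => //.
- by apply: le_lt_trans (probability_le1 mu mD) _; rewrite ltry.
- exact: measurable_funTS.
exists M; split; first exact: num_real.
by move=> t Mt x Dx; apply: le_trans (fM x Dx) (ltW Mt).
Qed.

Lemma eq_integral_full d (T : measurableType d) (mu : probability T R)
    (D : set T) (f g : T -> \bar R) :
  measurable D -> mu (~` D) = 0 ->
  mu.-integrable setT f -> mu.-integrable setT g -> (forall x, D x -> f x = g x) ->
  (\int[mu]_x f x = \int[mu]_x g x)%E.
Proof.
move=> mD D0 fi gi fg.
rewrite (negligible_integral (measurableC mD) measurableT fi D0).
rewrite (negligible_integral (measurableC mD) measurableT gi D0) setTD setCK.
by apply: eq_integral => x; rewrite inE => /fg.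
Qed.

Lemma integral_full_ge0 d (T : measurableType d) (mu : probability T R)
    (D : set T) (f : T -> \bar R) :
  measurable D -> mu (~` D) = 0 -> mu.-integrable setT f ->
  (forall x, D x -> 0 <= f x)%E -> (0 <= \int[mu]_x f x)%E.
Proof.
move=> mD D0 fi f0.
rewrite (negligible_integral (measurableC mD) measurableT fi D0) setTD setCK.
exact: integral_ge0.
Qed.

(** [e^-1 * A] is the density of a coupling of [mu] and [nu], so the integral of
    [A z * (u z.1 + v z.2)] is [e] times the sum of the integrals of [u] and [v]. *)
Lemma dual_pairing_ge0 d1 d2 (X : measurableType d1) (Y : measurableType d2)
    (mu : probability X R) (nu : probability Y R) (A : X * Y -> R)
    (u : X -> R) (v : Y -> R) (D : set X) (e : R) :
  measurable_fun setT A -> (forall z, 0 <= A z) -> 0 < e ->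
  (forall x, \int[nu]_y (A (x, y))%:E = e%:E)%E ->
  (forall y, \int[mu]_x (A (x, y))%:E = e%:E)%E ->
  mu.-integrable setT (EFin \o u) -> nu.-integrable setT (EFin \o v) ->
  measurable D -> mu (~` D) = 0 ->
  (forall x y, D x -> 0 <= A (x, y) * (u x + v y)) ->
  (0 <= \int[mu]_x (u x)%:E + \int[nu]_y (v y)%:E)%E.
Proof.
move=> mA A0 e0 Ax Ay iu iv mD D0 Duv.
have mu_ : measurable_fun setT u by apply/measurable_EFinP; exact: (measurable_int _ iu).
have mv_ : measurable_fun setT v by apply/measurable_EFinP; exact: (measurable_int _ iv).
pose f1 (z : X * Y) := A z * u z.1; pose f2 (z : X * Y) := A z * v z.2.
have mf1 : measurable_fun setT (EFin \o f1).
  apply/measurable_EFinP; apply: measurable_funM => //.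
  exact: (measurableT_comp mu_ measurable_fst).
have mf2 : measurable_fun setT (EFin \o f2).
  apply/measurable_EFinP; apply: measurable_funM => //.
  exact: (measurableT_comp mv_ measurable_snd).
have mAx x : measurable_fun setT (fun y => (A (x, y))%:E).
  by apply/measurable_EFinP; exact: (measurable_fun_pair2 x mA).
have mAy y : measurable_fun setT (fun x => (A (x, y))%:E).
  by apply/measurable_EFinP; exact: (measurable_fun_pair1 y mA).
have iAx x : nu.-integrable setT (fun y => (A (x, y))%:E).
  apply/integrableP; split; first exact: mAx.
  rewrite -(_ : e%:E = \int[nu]_y `|(A (x, y))%:E|)%E ?ltry // -(Ax x).
  by apply: eq_integral => y _; rewrite gee0_abs ?lee_fin.
have iAy y : mu.-integrable setT (fun x => (A (x, y))%:E).
  apply/integrableP; split; first exact: mAy.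
  rewrite -(_ : e%:E = \int[mu]_x `|(A (x, y))%:E|)%E ?ltry // -(Ay y).
  by apply: eq_integral => x _; rewrite gee0_abs ?lee_fin.
have if1 : (mu \x nu)%E.-integrable setT (EFin \o f1).
  apply: (integrable12ltyP mu nu mf1).2.
  rewrite (_ : (fun x => _) = (fun x => e%:E * `|(u x)%:E|)%E).
    rewrite ge0_integralZl //; last 2 first.
    - by apply: measurableT_comp => //; exact/measurable_EFinP.
    - by rewrite lee_fin ltW.
    by case/integrableP : iu => _ iu; apply: lte_mul_pinfty => //; rewrite lee_fin ltW.
  apply/funext => x; rewrite muleC -(Ax x) -ge0_integralZl //.
  - apply: eq_integral => y _.
    by rewrite /f1 /= normrM (ger0_norm (A0 _)) mulrC EFinM.
  - by move=> y _; rewrite lee_fin.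
have if2 : (mu \x nu)%E.-integrable setT (EFin \o f2).
  apply: (integrable21ltyP mu nu mf2).2.
  rewrite (_ : (fun y => _) = (fun y => e%:E * `|(v y)%:E|)%E).
    rewrite ge0_integralZl //; last 2 first.
    - by apply: measurableT_comp => //; exact/measurable_EFinP.
    - by rewrite lee_fin ltW.
    by case/integrableP : iv => _ iv; apply: lte_mul_pinfty => //; rewrite lee_fin ltW.
  apply/funext => y; rewrite muleC -(Ay y) -ge0_integralZl //.
  - apply: eq_integral => x _.
    by rewrite /f2 /= normrM (ger0_norm (A0 _)) mulrC EFinM.
  - by move=> x _; rewrite lee_fin.
have I1 : (\int[mu \x nu]_z (f1 z)%:E = e%:E * \int[mu]_x (u x)%:E)%E.
  rewrite -(integral12_prod_meas1 if1) -integralZl //; apply: eq_integral => x _.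
  rewrite muleC -(Ax x) -integralZl //; apply: eq_integral => y _.
  by rewrite /f1 /= mulrC EFinM.
have I2 : (\int[mu \x nu]_z (f2 z)%:E = e%:E * \int[nu]_y (v y)%:E)%E.
  rewrite -(integral21_prod_meas1 if2) -integralZl //; apply: eq_integral => y _.
  rewrite muleC -(Ay y) -integralZl //; apply: eq_integral => x _.
  by rewrite /f2 /= mulrC EFinM.
have i12 := integrableD measurableT if1 if2.
have : (0 <= \int[mu \x nu]_z ((f1 z)%:E + (f2 z)%:E))%E.
  rewrite -(integral12_prod_meas1 i12).
  apply: (integral_full_ge0 mD D0 (integrable_fubini_F i12)) => x Dx.
  apply: integral_ge0 => y _.
  by rewrite /= /f1 /f2 /= -EFinD lee_fin -mulrDr Duv.
rewrite integralD // I1 I2.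
have fu := integrable_fin_num measurableT iu.
have fv := integrable_fin_num measurableT iv.
move: fu fv; rewrite /comp => /fineK <- /fineK <-.
by rewrite -!EFinM -!EFinD !lee_fin -mulrDr pmulr_rge0.
Qed.

End integration_lemmas.

(** * The Brenier map *)

Section segments.
Context {R : realType} {d : nat}.
Implicit Types (x y p : 'rV[R]_d) (A : set 'rV[R]_d).

(** The last point of [A] on the segment from [x] is a boundary point. *)
Lemma segment_exit_boundary A x y : A x -> ~ A y ->
  exists2 p, boundary A p & enorm (x - p) <= enorm (x - y).
Proof.
move=> Ax nAy; pose w := y - x; pose K := enorm w + 1.
have K0 : 0 < K by rewrite ltr_wpDl ?enorm_ge0.
have wK : enorm w < K by rewrite ltrDl.
pose T := [set s : R | 0 <= s <= 1 /\ A (x + s *: w)].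
have T0 : T 0 by rewrite /T /= lexx ler01 scale0r addr0.
have ubT : ubound T 1 by move=> s [/andP[]].
have hT : has_sup T by split; [exists 0|exists 1].
pose s0 := sup T; pose p := x + s0 *: w.
have s00 : 0 <= s0 by apply: ub_le_sup => //; exists 1.
have s01 : s0 <= 1 by apply: ge_sup => //; exists 0.
have dist_p s : enorm ((x + s *: w) - p) = `|s - s0| * enorm w.
  by rewrite /p opprD addrACA subrr add0r -scalerBl enormZ.
have near_p s r : 0 < r -> `|s - s0| < r / K -> enorm ((x + s *: w) - p) < r.
  move=> r0; rewrite dist_p ltr_pdivlMr // => sr; apply: le_lt_trans sr.
  by rewrite ler_wpM2l // ltW.
exists p.
  split.
    apply/closure_eballP => r r0.
    have [s Ts s0s] := sup_adherent (divr_gt0 r0 K0) hT.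
    exists (x + s *: w); first by case: Ts.
    apply: near_p => //; have ss0 : s <= s0 by apply: ub_le_sup => //; exists 1.
    by rewrite ler0_norm ?subr_le0 // opprB ltrBlDl -ltrBlDr.
  move=> /nbhs_eballP[r r0 pA].
  have s0_lt1 : s0 < 1.
    rewrite lt_neqAle s01 andbT; apply/eqP => s0E; apply: nAy.
    by have := pA p (eball_center p r0); rewrite /p s0E scale1r /w addrC subrK.
  pose s := Num.min 1 (s0 + r / K / 2).
  have rK0 : 0 < r / K / 2 by rewrite !divr_gt0.
  have ss0 : s0 < s by rewrite lt_min s0_lt1 ltrDl.
  suff : T s by move=> /(ub_le_sup (ex_intro _ 1 ubT)); rewrite leNgt ss0.
  split; first by rewrite ge_min lexx (ltW (le_lt_trans s00 ss0)).
  apply: pA; rewrite /eball /=; apply: near_p => //.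
  have : s <= s0 + r / K / 2 by rewrite ge_min lexx orbT.
  by rewrite gtr0_norm ?subr_gt0 //; move: rK0; lra.
rewrite /p opprD addNKr enormN enormZ ger0_norm // enorm_distC.
by rewrite ler_piMl ?enorm_ge0.
Qed.

Lemma mem_of_lt_dist_boundary A x y : A x ->
  enorm (x - y) < dist_to_set x (boundary A) -> A y.
Proof.
move=> Ax xy; apply: contrapT => /(segment_exit_boundary Ax)[p bp px].
suff : dist_to_set x (boundary A) <= enorm (x - p).
  by rewrite leNgt (le_lt_trans px xy).
by apply: ge_inf; [exists 0 => _ [q _ <-]; exact: enorm_ge0|exists p].
Qed.

End segments.

Section brenier_map_gap.
Context {R : realType} {d : nat} (mu nu : probability 'rV[R]_d R).
Variables (phi F G : 'rV[R]_d -> R) (L e : R).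
Hypothesis mu_ball : spt mu `<=` eball 0 1.
Hypothesis nu_ball : spt nu `<=` eball 0 1.
Hypothesis phi_brenier : brenier_potential mu nu phi.
Hypothesis L0 : 0 <= L.
Hypothesis phi_smooth : lipschitz_gradient L phi.
Hypothesis e0 : 0 < e.
Hypothesis F_lip : forall x y, `|F x - F y| <= enorm (x - y).
Hypothesis G_lip : forall x y, `|G x - G y| <= enorm (x - y).
Hypothesis int_mu :
  (forall y, \int[mu]_x (Num.max 0 (slack F G x y))%:E = e%:E)%E.
Hypothesis int_nu :
  (forall x, \int[nu]_y (Num.max 0 (slack F G x y))%:E = e%:E)%E.

Let convex_phi : convex_function [set: convex_lmodType 'rV[R]_d] phi.
Proof. by case: phi_brenier. Qed.

Let diff_phi x : differentiable phi x.
Proof. by case: phi_smooth. Qed.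

Let grad_lip x y : enorm (grad phi x - grad phi y) <= L * enorm (x - y).
Proof. by case: phi_smooth. Qed.

Let continuous_of_lip (f : 'rV[R]_d -> R) :
  (forall x y, `|f x - f y| <= enorm (x - y)) -> continuous f.
Proof.
by move=> fl; apply: (@enorm_lipschitz_continuous _ _ _ 1) => x y; rewrite mul1r.
Qed.

Let mF : measurable_fun setT F.
Proof. exact: continuous_measurable_fun_rV (continuous_of_lip F_lip). Qed.

Let mG : measurable_fun setT G.
Proof. exact: continuous_measurable_fun_rV (continuous_of_lip G_lip). Qed.

Let grad_continuous : continuous (grad phi).
Proof.
move=> x A /nbhs_eballP[r r0 rA]; apply/nbhs_eballP.
have L1 : 0 < L + 1 by rewrite ltr_wpDl.
exists (r / (L + 1)); first by rewrite divr_gt0.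
move=> y; rewrite /eball /= ltr_pdivlMr // => yx; apply: rA.
rewrite /eball /=; apply: le_lt_trans (grad_lip _ _) _; apply: le_lt_trans yx.
by rewrite mulrC ler_wpM2l ?enorm_ge0 // lerDl.
Qed.

Let mgrad : measurable_fun setT (grad phi).
Proof. exact: continuous_measurable_fun_rV_rV. Qed.

(** Otherwise, by continuity, [grad phi] would send a ball around [x], which has
    positive mass, outside the unit ball, where [nu] has no mass. *)
Lemma enorm_grad_le1 x : spt mu x -> enorm (grad phi x) <= 1.
Proof.
move=> xs; rewrite leNgt; apply/negP => gx.
have L1 : 0 < L + 1 by rewrite ltr_wpDl.
pose r := (enorm (grad phi x) - 1) / (L + 1).
have r0 : 0 < r by rewrite divr_gt0 // subr_gt0.
have := xs r r0; rewrite ltNge => /negP; apply.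
have := measure_eball01C nu_ball; rewrite phi_brenier.2; last first.
  by apply: measurableC; exact: measurable_eball.
move=> <-; apply: le_measure; rewrite ?inE; first exact: measurable_eball.
  rewrite -[X in measurable X]setTI; apply: mgrad => //.
  by apply: measurableC; exact: measurable_eball.
move=> y; rewrite /eball /= subr0 => yx; apply/negP; rewrite -leNgt.
have := ler_dist_enorm (grad phi x) (grad phi y); have := grad_lip x y.
have : L * enorm (x - y) <= (L + 1) * r.
  rewrite enorm_distC; apply: (@le_trans _ _ ((L + 1) * enorm (y - x))).
    by rewrite ler_wpM2r ?enorm_ge0 // lerDl.
  by rewrite ler_wpM2l ?ltW.
have -> : (L + 1) * r = enorm (grad phi x) - 1 by rewrite /r mulrC divfK // gt_eqF.
lra.
Qed.

(** The pointwise defect of complementary slackness of [F] and [G] on the graph of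
    the Brenier map: for exact dual potentials it would vanish. *)
Definition gap x : R := slack F G x (grad phi x).

Lemma gap_le x : spt mu x -> gap x <= 3 * spread mu e.
Proof. by move=> xs; apply: (slack_le_spread mF mG) => //; exact: enorm_grad_le1. Qed.

Let psi := ball_conjugate phi.

Let psi_lip y z : `|psi y - psi z| <= enorm (y - z).
Proof. exact: ball_conjugate_lipschitz. Qed.

Let bounded_of_lip (f : 'rV[R]_d -> R) x :
  (forall x y, `|f x - f y| <= enorm (x - y)) -> enorm x <= 1 ->
  `|f x| <= `|f 0| + 1.
Proof.
move=> fl x1; rewrite -[f x](subrK (f 0)) addrC.
apply: le_trans (ler_normD _ _) _; rewrite lerD2l.
by apply: le_trans (fl _ _) _; rewrite subr0.
Qed.

Let phi_bounded x : enorm x <= 1 ->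
  `|phi x| <= `|phi 0| + (enorm (grad phi 0) + L).
Proof.
move=> x1.
have := convex_tangent convex_phi x (diff_phi 0).
have := convex_tangent convex_phi 0 (diff_phi x).
rewrite subr0 sub0r -scaleN1r edotZr.
have := edot_abs_le (grad phi 0) x; rewrite ler_norml => /andP[g0 _].
have := edot_le (grad phi x) x; have := ler_dist_enorm (grad phi x) (grad phi 0).
have := grad_lip x 0; rewrite subr0.
have : L * enorm x <= L by rewrite ler_piMr.
have : enorm (grad phi 0) * enorm x <= enorm (grad phi 0).
  by rewrite ler_piMr ?enorm_ge0.
have : enorm (grad phi x) * enorm x <= enorm (grad phi x).
  by rewrite ler_piMr ?enorm_ge0.
move: (ler_norm (phi 0)) (ler_norm (- phi 0)) L0; rewrite normrN ler_norml.
by move=> n1 n2 L0' h1 h2 h3 h4 h5 h6 h7 h8; apply/andP; split; lra.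
Qed.

Lemma measurable_gap : measurable_fun setT gap.
Proof.
have mpair : measurable_fun setT (fun x => (x, grad phi x)).
  by apply: measurable_fun_pair => //; exact: measurable_id.
apply: measurable_funB; last exact: (measurableT_comp mG mgrad).
by apply: measurable_funB mF; exact: (measurableT_comp measurable_edot mpair).
Qed.

(** With [psi] the convex conjugate of [phi], the sum [u + v] of [u := phi - F] and
    [v := psi - G] is nonnegative wherever the slack is positive, because
    [phi x + psi y >= edot x y]. Pairing with the positive part of the slack gives
    that the integrals of [u] and [v] add up to something nonnegative; transporting
    [v] back by [grad phi] turns this sum into the integral of the gap, as
    [phi x + psi (grad phi x) = edot x (grad phi x)]. *)
Lemma integral_gap_ge0 :
  mu.-integrable setT (EFin \o gap) /\ (0 <= \int[mu]_x (gap x)%:E)%E.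
Proof.
pose B : set 'rV[R]_d := eball 0 1.
have mB : measurable B := measurable_eball 0 1.
have muB : mu (~` B) = 0 := measure_eball01C mu_ball.
have nuB : nu (~` B) = 0 := measure_eball01C nu_ball.
pose u x := phi x - F x; pose v y := psi y - G y.
have mphi : measurable_fun setT phi.
  by apply: continuous_measurable_fun_rV => x; exact: differentiable_continuous.
have mpsi : measurable_fun setT psi.
  exact: continuous_measurable_fun_rV (continuous_of_lip psi_lip).
have mu_ : measurable_fun setT u by exact: measurable_funB.
have mv_ : measurable_fun setT v by exact: measurable_funB.
have ball_le1 x : B x -> enorm x <= 1 by rewrite /B /eball /= subr0 => /ltW.
have v_bounded y : enorm y <= 1 -> `|v y| <= (`|psi 0| + 1) + (`|G 0| + 1).
  move=> y1; apply: le_trans (ler_normB _ _) _.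
  exact: lerD (bounded_of_lip psi_lip y1) (bounded_of_lip G_lip y1).
have u_bounded x : enorm x <= 1 ->
    `|u x| <= `|phi 0| + (enorm (grad phi 0) + L) + (`|F 0| + 1).
  move=> x1; apply: le_trans (ler_normB _ _) _.
  exact: lerD (phi_bounded x1) (bounded_of_lip F_lip x1).
have iu : mu.-integrable setT (EFin \o u).
  by apply: (ae_bounded_integrable mB muB mu_) => x /ball_le1; exact: u_bounded.
have iv : nu.-integrable setT (EFin \o v).
  by apply: (ae_bounded_integrable mB nuB mv_) => y /ball_le1; exact: v_bounded.
have ivg : mu.-integrable setT (EFin \o (v \o grad phi)).
  apply: (ae_bounded_integrable (measurable_spt mu) (measure_sptC mu)).
    exact: measurableT_comp mv_ mgrad.
  by move=> x xs; apply: v_bounded; exact: enorm_grad_le1.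
have Iv : (\int[nu]_y (v y)%:E = \int[mu]_x (v (grad phi x))%:E)%E.
  rewrite (eq_measure_integral (pushforward mu (grad phi))); last first.
    by move=> A mA _; exact: phi_brenier.2.
  rewrite (integral_pushforward mgrad) ?preimage_setT //.
  exact/measurable_EFinP.
have uv_gap x : B x -> u x + v (grad phi x) = gap x.
  move=> /ball_le1 x1.
  rewrite /u /v /psi (ball_conjugate_grad convex_phi diff_phi x1) /gap /slack.
  by lra.
have uv_ge0 : (0 <= \int[mu]_x (u x)%:E + \int[nu]_y (v y)%:E)%E.
  apply: (dual_pairing_ge0 (measurable_slack mF mG) _ e0 _ _ iu iv mB muB) => //.
  - by move=> z; rewrite le_max lexx.
  move=> x y /ball_le1 x1.
  have := ball_conjugate_ge convex_phi diff_phi y x1.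
  rewrite /u /v /psi; case: (lerP 0 (slack F G x y)) => s0 px.
    by rewrite mulr_ge0 // -subr_ge0; move: s0; rewrite /slack; lra.
  by rewrite mul0r.
have iuv := integrableD measurableT iu ivg.
have igap : mu.-integrable setT (EFin \o gap).
  apply: (ae_bounded_integrable (measurable_spt mu) (measure_sptC mu) measurable_gap).
  move=> x xs; have /ball_le1 x1 := mu_ball xs.
  rewrite -uv_gap; last exact: mu_ball.
  apply: le_trans (ler_normD _ _) _.
  exact: lerD (u_bounded _ x1) (v_bounded _ (enorm_grad_le1 xs)).
split=> //; rewrite (eq_integral_full mB muB igap iuv).
  by rewrite integralD // -Iv.
by move=> x Bx; rewrite /= -uv_gap.
Qed.

(** The unit ball bounds [x], [y] and the gradients there; [edot x (grad phi x)]
    contributes [1 + L], and [F] and [G] composed with the gradient contribute [1]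
    and [L]. *)
Lemma gap_lipschitz x y : spt mu x -> spt mu y ->
  gap x <= gap y + 2 * (L + 1) * enorm (x - y).
Proof.
move=> xs ys; have := mu_ball ys; rewrite /eball /= subr0 => /ltW y1.
have gx1 := enorm_grad_le1 xs.
have := edot_le (x - y) (grad phi x); rewrite edotBl.
have := edot_le y (grad phi x - grad phi y); rewrite edotBr.
have := F_lip y x; rewrite enorm_distC ler_norml => /andP[_].
have := G_lip (grad phi y) (grad phi x).
rewrite enorm_distC ler_norml => /andP[_].
have := grad_lip x y.
have : enorm (x - y) * enorm (grad phi x) <= enorm (x - y).
  by rewrite ler_piMr ?enorm_ge0.
have : enorm y * enorm (grad phi x - grad phi y) <= enorm (grad phi x - grad phi y).
  by rewrite ler_piMl ?enorm_ge0.
by rewrite /gap /slack; lra.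
Qed.

(** If the gap is [- s] at [x], it is below [- s / 2] on the ball of radius
    [s / (4 * (L + 1))] around [x]. As it is at most [3 * spread mu e] on the
    support and has nonnegative integral, that ball has mass at most
    [6 * spread mu e / s], which bounds [s] by the definition of the spread. *)
Lemma gap_ge x : spt mu x ->
  - (8 * (L + 1) * spread mu (spread mu e / (L + 1))) <= gap x.
Proof.
move=> xs; rewrite leNgt; apply/negP => gx.
have L1 : 0 < L + 1 by rewrite ltr_wpDl.
set t := spread mu e / (L + 1); set D := spread mu t.
have sp0 : 0 < spread mu e := lt_le_trans e0 (spread_ge mu_ball e).
have t0 : 0 < t by rewrite divr_gt0.
have D0 : 0 < D := lt_le_trans t0 (spread_ge mu_ball t).
pose s := - gap x; pose r := s / (4 * (L + 1)).
have sE : s = 4 * (L + 1) * r by rewrite /r mulrC divfK // gt_eqF // mulr_gt0.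
(* Half the radius is used below: the resulting factor beats the constant 3. *)
have r_gt : D < r / 2.
  rewrite ltr_pdivlMr // /r ltr_pdivlMr ?mulr_gt0 // /s.
  by move: gx; rewrite -/t -/D; lra.
have := lt_mass_of_spread_lt mu_ball r_gt.
have r0 : 0 < r by have := lt_trans D0 r_gt; rewrite pmulr_lgt0.
have s0 : 0 < s by rewrite sE mulr_gt0 // mulr_gt0.
have mle : min_mass mu (r / 2) <= fine (mu (eball x r)).
  apply: le_trans (min_mass_le r xs); apply: min_mass_mono.
  by rewrite ler_pdivrMr // ler_peMr ?ler1n // ltW.
suff ms : s / 2 * fine (mu (eball x r)) <= 3 * spread mu e.
  have m_le : r / 2 * min_mass mu (r / 2) <= r / 2 * fine (mu (eball x r)).
    by rewrite ler_wpM2l // divr_ge0 // ltW.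
  have tE : spread mu e = t * (L + 1) by rewrite divfK // gt_eqF.
  move: ms; rewrite sE tE => ms t_lt.
  have : 2 * r * fine (mu (eball x r)) <= 3 * t.
    by rewrite -(ler_pM2r L1); move: ms; lra.
  by move: t_lt t0 m_le; lra.
have [ig Ig] := integral_gap_ge0.
pose B := eball x r; have mB : measurable B := measurable_eball x r.
have iB : mu.-integrable setT (fun y => (s / 2)%:E * (\1_B y)%:E)%E.
  by apply: integrableZl => //; exact: integrable_indic.
have iC : mu.-integrable setT (cst (3 * spread mu e)%:E).
  exact: finite_measure_integrable_cst.
have igB := integrableD measurableT ig iB.
have : (0 <= \int[mu]_y ((3 * spread mu e)%:E -
    ((gap y)%:E + (s / 2)%:E * (\1_B y)%:E)))%E.
  apply: (integral_full_ge0 (measurable_spt mu) (measure_sptC mu)).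
    exact: integrableB.
  move=> y ys.
  rewrite -[X in (0 <= X)%E]/((3 * spread mu e - (gap y + s / 2 * \1_B y))%:E).
  rewrite lee_fin subr_ge0 indicE.
  have [|_] := boolP (y \in B); last by rewrite mulr0 addr0; exact: gap_le.
  rewrite inE /B /eball /= => yx; have := gap_lipschitz ys xs.
  have : 2 * (L + 1) * enorm (y - x) <= 2 * (L + 1) * r.
    by rewrite ler_wpM2l ?mulr_ge0 // ltW.
  by rewrite /s in sE *; move: sp0; lra.
have IB : (\int[mu]_y ((s / 2)%:E * (\1_B y)%:E) = (s / 2)%:E * mu B)%E.
  by rewrite integralZl ?integral_indic ?setIT //; exact: integrable_indic.
have IC : (\int[mu]_y (cst (3 * spread mu e)%:E y) = (3 * spread mu e)%:E)%E.
  rewrite integral_cst // -[RHS]mule1; congr (_ * _)%E; exact: probability_setT.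
rewrite (integralB measurableT iC igB) IC (integralD measurableT ig iB) IB.
have gE := fineK (integrable_fin_num measurableT ig).
move: Ig; rewrite -gE -(fineK (fin_num_measure mu B mB)) lee_fin.
move: (fine (integral _ _ _)) => g g0.
rewrite -[X in (0 <= X)%E]/((3 * spread mu e - (g + s / 2 * fine (mu B)))%:E) lee_fin.
by move: g0; rewrite /B; lra.
Qed.

(** Minty's trick. The slack is nonnegative at [(x, y)], almost nonnegative at
    [(x', grad phi x')], and almost nonpositive at the two crossed pairs, so [x - x']
    and [y - grad phi x'] are monotonically related up to an error of order
    [(L + 1) * q ^+ 2]. Choosing [x - x'] of length [q] opposite to [y - grad phi x],
    this error and the error [L * q] from replacing [grad phi x'] by [grad phi x] both
    contribute at most a multiple of [(L + 1) * q] to the distance. *)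
Lemma dist_to_brenier_map x y :
  let q := Num.sqrt (spread mu (spread mu e / (L + 1))) in
  spt mu x -> enorm y <= 1 -> 0 <= slack F G x y ->
  enorm (y - grad phi x) <= 15 * (L + 1) * q \/
  dist_to_set x (boundary (spt mu)) <= q.
Proof.
move=> q xs y1 sxy.
have L1 : 0 < L + 1 by rewrite ltr_wpDl.
have sp0 : 0 < spread mu e := lt_le_trans e0 (spread_ge mu_ball e).
have D_ge := spread_ge mu_ball (spread mu e / (L + 1)).
have D0 := lt_le_trans (divr_gt0 sp0 L1) D_ge.
have q0 : 0 < q by rewrite sqrtr_gt0.
have qq : q ^+ 2 = spread mu (spread mu e / (L + 1)) by rewrite sqr_sqrtr // ltW.
have sp_le : spread mu e <= (L + 1) * q ^+ 2.
  by rewrite qq mulrC -ler_pdivrMr.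
have [dq|dq] := lerP (dist_to_set x (boundary (spt mu))) q; [by right|left].
pose z := y - grad phi x; rewrite -/z.
have [n0|n_neq0] := eqVneq (enorm z) 0.
  by rewrite n0 !mulr_ge0 // ltW.
have n0 : 0 < enorm z by rewrite lt_neqAle eq_sym n_neq0 enorm_ge0.
pose w := (q / enorm z) *: z; pose x' := x + w.
have wq : enorm w = q.
  by rewrite /w enormZ ger0_norm ?divr_ge0 ?enorm_ge0 ?ltW // divfK.
have xx' : enorm (x - x') = q by rewrite /x' opprD addNKr enormN.
have x's : spt mu x' by apply: mem_of_lt_dist_boundary xs _; rewrite xx'.
have gx'1 := enorm_grad_le1 x's.
have c1 := slack_le_spread mF mG mu_ball e0 F_lip int_mu xs gx'1.
have c2 := slack_le_spread mF mG mu_ball e0 F_lip int_mu x's y1.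
have c3 := gap_ge x's.
have wz : edot w z = q * enorm z.
  by rewrite /w edotZl -sqr_enorm expr2 mulrA divfK.
have cross : slack F G x y + gap x' - slack F G x (grad phi x') - slack F G x' y =
    - (edot w z + edot w (grad phi x - grad phi x')).
  rewrite -edotDr; have -> : z + (grad phi x - grad phi x') = y - grad phi x'.
    by rewrite /z addrA subrK.
  rewrite /gap /slack /x' edotBr !edotDl.
  by ring.
have lipw : - (L * q ^+ 2) <= edot w (grad phi x - grad phi x').
  have := edot_abs_le w (grad phi x - grad phi x'); rewrite ler_norml => /andP[+ _].
  apply: le_trans; rewrite lerN2 wq expr2 mulrCA ler_wpM2l ?(ltW q0) //.
  by rewrite -[in leRHS]xx' grad_lip.
rewrite -(ler_pM2l q0) -wz.
rewrite -qq in c3; move: cross lipw c1 c2 c3 sxy sp_le.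
have -> : q * (15 * (L + 1) * q) = 14 * ((L + 1) * q ^+ 2) + L * q ^+ 2 + q ^+ 2.
  by ring.
have := sqr_ge0 q.
have -> : 8 * (L + 1) * q ^+ 2 = 8 * ((L + 1) * q ^+ 2) by ring.
by move: ((L + 1) * _) (L * _) => a b; lra.
Qed.

End brenier_map_gap.

(** * Quadratically regularized transport *)

Section quadratically_regularized_transport.
Context {R : realType} {d : nat}.
Implicit Types (mu nu : probability 'rV[R]_d R) (f g : 'rV[R]_d -> R).

(** Completing the square: this change of potentials replaces the quadratic cost by
    the bilinear one. *)
Definition half_sqr_minus f x : R := enorm x ^+ 2 / 2 - f x.

Lemma slack_half_sqr_minus f g x y :
  slack (half_sqr_minus f) (half_sqr_minus g) x y = f x + g y - quad_cost x y.
Proof.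
rewrite /slack /half_sqr_minus /quad_cost !sqr_enorm edotBl !edotBr (edotC y x).
by field.
Qed.

Lemma measurable_half_sqr_minus f :
  continuous f -> measurable_fun setT (half_sqr_minus f).
Proof.
move=> cf; apply: measurable_funB; last exact: continuous_measurable_fun_rV.
apply: measurable_funM; last exact: measurable_cst.
under eq_fun do rewrite sqr_enorm.
have mdiag : measurable_fun setT (fun x : 'rV[R]_d => (x, x)).
  by apply: measurable_fun_pair; exact: measurable_id.
exact: (measurableT_comp measurable_edot mdiag).
Qed.

Lemma qot_spt_approx mu nu f g x y r : qot_spt mu nu f g (x, y) -> 0 < r ->
  exists x' y', [/\ spt mu x', spt nu y', enorm (x' - x) < r, enorm (y' - y) < r &
    0 < slack (half_sqr_minus f) (half_sqr_minus g) x' y'].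
Proof.
move=> sxy r0.
have [|[x' y'] [[[/= xs ys] sl] [/= xx yy]]] := sxy (eball x r `*` eball y r).
  exists (eball x r, eball y r) => //=.
  by split; apply/nbhs_eballP; exists r.
by exists x', y'; split=> //; rewrite slack_half_sqr_minus subr_gt0.
Qed.

End quadratically_regularized_transport.

Unset Implicit Arguments.

Theorem theorem5p2 (R : realType) :
  exists C : R, 0 < C /\
  forall (d : nat) (mu nu : probability 'rV[R]_d R) (phi : 'rV[R]_d -> R)
    (L eps : R) (pi_eps : probability ('rV[R]_d * 'rV[R]_d)%type R)
    (f_eps g_eps : 'rV[R]_d -> R),
    mu `<< @lebesgue_outer R d ->
    spt mu `<=` eball 0 1 ->
    connected (interior (spt mu)) ->
    spt nu `<=` eball 0 1 ->
    brenier_potential mu nu phi ->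
    0 <= L ->
    lipschitz_gradient L phi ->
    0 < eps ->
    qot_plan mu nu eps pi_eps ->
    qot_potentials mu nu eps pi_eps f_eps g_eps ->
    let r := C * (L + 1) `^ (3 / 2) *
               Num.sqrt (spread mu (spread mu eps / (L + 1))) in
    forall x y : 'rV[R]_d, qot_spt mu nu f_eps g_eps (x, y) ->
      enorm (y - grad phi x) <= r \/ dist_to_set x (boundary (spt mu)) <= r.
Proof.
exists 15; split; first exact: ltr0n.
move=> d mu nu phi L eps pi_eps f g _ mu_ball _ nu_ball phi_brenier L0 phi_smooth
  eps0 _ [[cf cg] int_mu int_nu _] r x y sxy.
pose F := half_sqr_minus f; pose G := half_sqr_minus g.
have slackE x' y' : qot_slack f g x' y' = Num.max 0 (slack F G x' y').
  by rewrite slack_half_sqr_minus.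
have mF : measurable_fun setT F := measurable_half_sqr_minus cf.
have mG : measurable_fun setT G := measurable_half_sqr_minus cg.
have Imu y' : (\int[mu]_x' (Num.max 0 (slack F G x' y'))%:E = eps%:E)%E.
  by rewrite -(int_mu y'); apply: eq_integral => x' _; rewrite slackE.
have Inu x' : (\int[nu]_y' (Num.max 0 (slack F G x' y'))%:E = eps%:E)%E.
  by rewrite -(int_nu x'); apply: eq_integral => y' _; rewrite slackE.
have F_lip := potential_lipschitz mF mG (measure_eball01C nu_ball) eps0 Inu.
have G_lip : forall y1 y2, `|G y1 - G y2| <= enorm (y1 - y2).
  apply: (potential_lipschitz mG mF (measure_eball01C mu_ball) eps0) => y'.
  by rewrite -(Imu y'); apply: eq_integral => x' _; rewrite slackC.
have xs : spt mu x.
  apply: closed_spt; apply/closure_eballP => s s0.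
  by have [x' [y' [? ? ? ? ?]]] := qot_spt_approx sxy s0; exists x'.
have ys : spt nu y.
  apply: closed_spt; apply/closure_eballP => s s0.
  by have [x' [y' [? ? ? ? ?]]] := qot_spt_approx sxy s0; exists y'.
have norm_le1 (z : 'rV[R]_d) : eball 0 1 z -> enorm z <= 1.
  by rewrite /eball /= subr0 => /ltW.
have sl0 : 0 <= slack F G x y.
  rewrite leNgt; apply/negP => slt.
  (* On the unit ball the slack is 2-Lipschitz in each variable, so moving both by
     less than this amount cannot make it positive. *)
  have s0 : 0 < - slack F G x y / 4 by rewrite divr_gt0 // oppr_gt0.
  have [x' [y' [x's y's xx yy]]] := qot_spt_approx sxy s0; rewrite -/F -/G.
  have := edot_le (x' - x) y'; rewrite edotBl.
  have := edot_le x (y' - y); rewrite edotBr.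
  have : enorm (x' - x) * enorm y' <= enorm (x' - x).
    by rewrite ler_piMr ?enorm_ge0 // norm_le1 //; exact: nu_ball.
  have : enorm x * enorm (y' - y) <= enorm (y' - y).
    by rewrite ler_piMl ?enorm_ge0 // norm_le1 //; exact: mu_ball.
  have := F_lip x' x; have := G_lip y' y; rewrite !ler_norml => /andP[+ _] /andP[+ _].
  by move: xx yy slt; rewrite /slack; lra.
pose q := Num.sqrt (spread mu (spread mu eps / (L + 1))).
have q0 : 0 <= q := sqrtr_ge0 _.
have L1 : 1 <= L + 1 by rewrite lerDr.
have powL : L + 1 <= (L + 1) `^ (3 / 2).
  rewrite -[leLHS]powRr1; last by rewrite (le_trans _ L1).
  by apply: ler_powR => //; rewrite ler_pdivlMr // mul1r ler_nat.
have Lq : 15 * (L + 1) * q <= r by rewrite /r -!mulrA ler_wpM2l // ler_wpM2r.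
have [near_map|near_bd] := dist_to_brenier_map mu_ball nu_ball phi_brenier L0 phi_smooth
  eps0 F_lip G_lip Imu Inu xs (norm_le1 _ (nu_ball _ ys)) sl0.
  by left; apply: le_trans near_map Lq.
right; apply: le_trans near_bd _; apply: le_trans Lq.
by rewrite -/q ler_peMl //; lra.
Qed.
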